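(* Let $\Gamma\cup\{\phi\trianglelefteq\psi\}$ be a set of consequence pairs. If $\phi\trianglelefteq\psi\in\mathbf{CL}(\Gamma)$, then every selection L-frame that validates all consequence pairs in $\Gamma$ validates $\phi\trianglelefteq\psi$.
   Context: Formulas: $\phi::=p\mid\top\mid\bot\mid\phi\wedge\phi\mid\phi\vee\phi\mid\phi\Rightarrow\phi$. $\mathbf{CL}(\Gamma)$ is the smallest set of consequence pairs $\phi\trianglelefteq\psi$ containing $\Gamma$, closed under uniform substitution, containing $p\trianglelefteq\top$, $\bot\trianglelefteq p$, $p\trianglelefteq p$, $p\wedge q\trianglelefteq p$, $p\wedge q\trianglelefteq q$, $p\trianglelefteq p\vee q$, $q\trianglelefteq p\vee q$, $\top\trianglelefteq p\Rightarrow\top$, $p\Rightarrow(q\wedge r)\trianglelefteq(p\Rightarrow q)\wedge(p\Rightarrow r)$, $(p\Rightarrow q)\wedge(p\Rightarrow r)\trianglelefteq p\Rightarrow(q\wedge r)$, and closed under the rules: transitivity (from $p\trianglelefteq q$, $q\trianglelefteq r$ infer $p\trianglelefteq r$), $\wedge$-introduction (from $r\trianglelefteq p$, $r\trianglelefteq q$ infer $r\trianglelefteq p\wedge q$), $\vee$-elimination (from $p\trianglelefteq r$, $q\trianglelefteq r$ infer $p\vee q\trianglelefteq r$), and congruence (from $p\trianglelefteq q$, $q\trianglelefteq p$ infer $p\Rightarrow r\trianglelefteq q\Rightarrow r$ and $r\Rightarrow p\trianglelefteq r\Rightarrow q$). A selection L-frame is a meet-semilattice $(X,1,\curlywedge)$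 (top $1$, $x\preccurlyeq y$ iff $x\curlywedge y=x$) with $s:X\times\mathcal F(X)\to\mathcal F(X)$ ($\mathcal F(X)$ the filters: upward closed, closed under finite meets) such that $s(1,a)=\{1\}$; $x\preccurlyeq y$ implies $s(y,a)\subseteq s(x,a)$; if $z\in s(x\curlywedge y,a)$ then there are $u\in s(x,a)$, $v\in s(y,a)$ with $u\curlywedge v\preccurlyeq z$. With a valuation $V$ (letters to filters): $x\Vdash p$ iff $x\in V(p)$; $\top$ always; $x\Vdash\bot$ iff $x=1$; $\wedge$ pointwise; $x\Vdash\phi\vee\psi$ iff some $y\Vdash\phi$, $z\Vdash\psi$ have $y\curlywedge z\preccurlyeq x$; $x\Vdash\phi\Rightarrow\psi$ iff $s(x,[\![\phi]\!])\subseteq[\![\psi]\!]$. A frame validates $\phi\trianglelefteq\psi$ if $[\![\phi]\!]\subseteq[\![\psi]\!]$ for all valuations. *)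

(* Defs.v *)
From mathcomp Require Import all_boot all_order.
From mathcomp Require Import boolp classical_sets.

Set Implicit Arguments.
Unset Strict Implicit.
Unset Printing Implicit Defensive.

Import Order.Theory.

Local Open Scope classical_set_scope.
Local Open Scope order_scope.

Section Syntax.
Variable P : Type.

Inductive form : Type :=
| Var of P
| Top
| Bot
| And of form & form
| Or of form & form
| Imp of form & form.

Fixpoint subst (sigma : P -> form) (phi : form) : form :=
  match phi with
  | Var p => sigma p
  | Top => Top
  | Bot => Bot
  | And phi psi => And (subst sigma phi) (subst sigma psi)
  | Or phi psi => Or (subst sigma phi) (subst sigma psi)
  | Imp phi psi => Imp (subst sigma phi) (subst sigma psi)
  end.

Definition cpair : Type := (form * form)%type.

End Syntax.

Arguments Top {P}.
Arguments Bot {P}.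

Notation "phi <|= psi" := ((phi, psi) : cpair _)
  (at level 70, no associativity) : form_scope.
Delimit Scope form_scope with form.
Local Open Scope form_scope.

(* In the axioms as in the rules, p, q and r stand for arbitrary formulas: with
   at least three letters this gives the same set as axioms on letters closed
   under substitution, and it does not depend on how many letters there are. *)
Inductive CL (P : Type) (Gamma : set (cpair P)) : set (cpair P) :=
| CL_hyp c : Gamma c -> CL Gamma c
| CL_subst sigma phi psi :
    CL Gamma (phi <|= psi) -> CL Gamma (subst sigma phi <|= subst sigma psi)
| CL_top p : CL Gamma (p <|= Top)
| CL_bot p : CL Gamma (Bot <|= p)
| CL_refl p : CL Gamma (p <|= p)
| CL_andl p q : CL Gamma (And p q <|= p)
| CL_andr p q : CL Gamma (And p q <|= q)
| CL_orl p q : CL Gamma (p <|= Or p q)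
| CL_orr p q : CL Gamma (q <|= Or p q)
| CL_imp_top p : CL Gamma (Top <|= Imp p Top)
| CL_imp_and p q r :
    CL Gamma (Imp p (And q r) <|= And (Imp p q) (Imp p r))
| CL_and_imp p q r :
    CL Gamma (And (Imp p q) (Imp p r) <|= Imp p (And q r))
| CL_trans p q r :
    CL Gamma (p <|= q) -> CL Gamma (q <|= r) -> CL Gamma (p <|= r)
| CL_and_intro p q r :
    CL Gamma (r <|= p) -> CL Gamma (r <|= q) -> CL Gamma (r <|= And p q)
| CL_or_elim p q r :
    CL Gamma (p <|= r) -> CL Gamma (q <|= r) -> CL Gamma (Or p q <|= r)
| CL_congr_l p q r :
    CL Gamma (p <|= q) -> CL Gamma (q <|= p) ->
    CL Gamma (Imp p r <|= Imp q r)
| CL_congr_r p q r :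
    CL Gamma (p <|= q) -> CL Gamma (q <|= p) ->
    CL Gamma (Imp r p <|= Imp r q).

(* Closure under finite meets includes the empty meet, i.e. the top. *)
Record is_slfilter d (X : tMeetSemilatticeType d) (a : set X) : Prop :=
  IsSLFilter {
    slfilter_top : a \top;
    slfilter_meet : forall x y, a x -> a y -> a (x `&` y);
    slfilter_up : forall x y, x <= y -> a x -> a y }.

Record slfilter d (X : tMeetSemilatticeType d) := SLFilter {
  elts :> set X;
  slfilterP : is_slfilter elts }.

Lemma slfilter_eq d (X : tMeetSemilatticeType d) (a b : slfilter X) :
  a = b :> set X -> a = b.
Proof.
by case: a b => [a Pa] [b Pb] /= ab; subst b; congr SLFilter; apply: Prop_irrelevance.
Qed.

Record selection_frame d := SelectionFrame {
  points :> tMeetSemilatticeType d;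
  sel : points -> slfilter points -> slfilter points;
  sel_top : forall a, sel \top a = [set \top] :> set points;
  sel_anti : forall x y a, x <= y -> (sel y a `<=` sel x a)%classic;
  sel_meet : forall x y a z, elts (sel (x `&` y) a) z ->
    exists u v, [/\ elts (sel x a) u, elts (sel y a) v & u `&` v <= z] }.

Section Semantics.
Variables (d : Order.disp_t) (F : selection_frame d).
Implicit Types a b : slfilter F.

Lemma topset_filter : is_slfilter [set: F].
Proof. by []. Qed.

Lemma botset_filter : is_slfilter [set (\top : F)].
Proof.
split=> //= [x y -> ->|x y xy x1]; first by rewrite meetxx.
by apply/eqP; rewrite -le1x -x1.
Qed.

Lemma andset_filter a b : is_slfilter (fun x : F => elts a x /\ elts b x).
Proof.
split=> [|x y [ax bx] [ay b_y]|x y xy [ax bx]].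
- by split; apply: slfilter_top (slfilterP _).
- by split; apply: slfilter_meet (slfilterP _) _ _ _ _.
- by split; apply: slfilter_up (slfilterP _) _ _ xy _.
Qed.

Lemma orset_filter a b :
  is_slfilter (fun x : F => exists y z, [/\ elts a y, elts b z & y `&` z <= x]).
Proof.
split.
- by exists \top, \top; split; rewrite ?lex1 //; apply: slfilter_top (slfilterP _).
- move=> x x' [y [z [ay bz yzx]]] [y' [z' [ay' bz' yzx']]].
  exists (y `&` y'), (z `&` z'); split.
  + exact: slfilter_meet (slfilterP a) _ _ ay ay'.
  + exact: slfilter_meet (slfilterP b) _ _ bz bz'.
  + by rewrite meetACA leI2.
- move=> x x' xx' [y [z [ay bz yzx]]].
  by exists y, z; split=> //; apply: le_trans xx'.
Qed.

Lemma impset_filter a b : is_slfilter (fun x : F => (sel x a `<=` b)%classic).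
Proof.
split.
- by rewrite sel_top => _ ->; apply: slfilter_top (slfilterP _).
- move=> x y xb yb z /sel_meet[u [v [xu yv uvz]]].
  apply: slfilter_up (slfilterP b) _ _ uvz _.
  exact: slfilter_meet (slfilterP b) _ _ (xb _ xu) (yb _ yv).
- by move=> x y xy xb z yz; apply: xb; apply: sel_anti xy _ yz.
Qed.

Fixpoint interp (P : Type) (V : P -> slfilter F) (phi : form P) : slfilter F :=
  match phi with
  | Var p => V p
  | Top => SLFilter topset_filter
  | Bot => SLFilter botset_filter
  | And phi psi => SLFilter (andset_filter (interp V phi) (interp V psi))
  | Or phi psi => SLFilter (orset_filter (interp V phi) (interp V psi))
  | Imp phi psi => SLFilter (impset_filter (interp V phi) (interp V psi))
  end.

Definition validates (P : Type) (c : cpair P) : Prop :=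
  forall V : P -> slfilter F, (interp V c.1 `<=` interp V c.2)%classic.

End Semantics.

(* Main.v *)
Require Import Defs.
From mathcomp Require Import all_boot all_order.
From mathcomp Require Import boolp classical_sets.

Import Order.Theory.

Local Open Scope order_scope.
Local Open Scope form_scope.

(** Soundness, by induction on the derivation for all valuations at once. Every formula denotes a
    filter, so denotations can themselves serve as a valuation: this handles substitution
    ([interp_subst]). Congruence holds because interderivable formulas denote the same filter
    ([interp_eq]). *)

Lemma interp_subst (P : Type) d (F : selection_frame d) (V : P -> slfilter F)
    (sigma : P -> form P) (phi : form P) :
  interp V (subst sigma phi) = interp (fun p => interp V (sigma p)) phi.
Proof. by elim: phi => //= [a IHa b IHb|a IHa b IHb|a IHa b IHb]; rewrite IHa IHb. Qed.

(** Equality of filters, beyond mutual inclusion, is what congruence requires: [sel] takes the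
    antecedent's filter as an argument and need not be monotone in it. *)
Lemma interp_eq (P : Type) d (F : selection_frame d) (V : P -> slfilter F)
    (phi psi : form P) :
  validates F (phi <|= psi) -> validates F (psi <|= phi) ->
  interp V phi = interp V psi.
Proof. by move=> le ge; apply/slfilter_eq/seteqP; split; [apply: le|apply: ge]. Qed.

Lemma CL_validates (P : Type) (Gamma : set (cpair P)) d (F : selection_frame d) :
  (forall c, Gamma c -> validates F c) ->
  forall c, CL Gamma c -> validates F c.
Proof.
move=> hGamma c.
elim=> {c} [c /hGamma //|sigma p q _ IH|p|p|p|p q|p q|p q|p q|p|p q r|p q r
  |p q r _ IHpq _ IHqr|p q r _ IHp _ IHq|p q r _ IHp _ IHq
  |p q r _ IHpq _ IHqp|p q r _ IHpq _ IHqp] V x /=.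
(* The induction hypothesis is used at the valuation sending [p] to [interp V (sigma p)]. *)
- by rewrite !interp_subst; apply: IH.
- by [].
- by move=> ->; apply: slfilter_top (slfilterP _).
- by [].
- by case.
- by case.
(* The top lies in every filter, so it serves as the point for the other disjunct. *)
- move=> px; exists x, \top; split; rewrite ?leIl //.
  exact: slfilter_top (slfilterP _).
- move=> qx; exists \top, x; split; rewrite ?leIr //.
  exact: slfilter_top (slfilterP _).
- by [].
- by move=> pqr; split=> z /pqr[].
- by move=> [pq pr] z xz; split; [apply: pq|apply: pr].
- by move=> /IHpq /IHqr.
- by move=> rx; split; [apply: IHp|apply: IHq].
(* Both points lie in the filter of [r], hence so do their meet and [x] above it. *)
- move=> [y [z [/IHp ry /IHq rz yzx]]].
  apply: slfilter_up (slfilterP _) _ _ yzx _.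
  exact: slfilter_meet (slfilterP _) _ _ ry rz.
- by rewrite (interp_eq _ _ _ V p q).
- by rewrite (interp_eq _ _ _ V p q).
Qed.

Theorem theorem3p15 (P : Type) (Gamma : set (cpair P)) (phi psi : form P) :
  CL Gamma (phi <|= psi) ->
  forall (d : Order.disp_t) (F : selection_frame d),
    (forall c, Gamma c -> validates F c) -> validates F (phi <|= psi).
Proof. by move=> phi_psi d F hGamma; apply: (CL_validates _ _ _ F hGamma). Qed.
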